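(* Let $\alpha,\beta,\gamma_1,\gamma_2$ satisfy $\alpha+\beta+\gamma_1+\gamma_2=1$, and assume the parameters lie on the generic locus where $\alpha,2\alpha,\beta,2\beta,\gamma_1-\gamma_2\notin\mathbb{Z}\setminus\{0\}$ and the operator has genuine order $3$; since all formulas are rational in the parameters, the conclusions extend by specialization to all non-degenerate points, including $(\alpha,\beta,\gamma_1,\gamma_2)=(0,0,\tfrac12,\tfrac12)$ and $(\alpha,\beta,\gamma_1,\gamma_2)=(-\tfrac12,0,\tfrac12,1)$. Consider the Riemann scheme $$z=0:\ \{0,\alpha,2\alpha\},\qquad z=1:\ \{0,\beta,2\beta\},\qquad z=\infty:\ \{\gamma_1+\gamma_2,\,2\gamma_1,\,2\gamma_2\}.$$ (a) There exists a one-parameter family $L_\lambda$ of monic order-$3$ Fuchsian operators on $\mathbb{P}^1\setminus\{0,1,\infty\}$ with this Riemann scheme, parametrized by an accessory parameter $\lambda$. In Euler form, $$\widetilde L_\lambda=\theta(\theta-\alpha)(\theta-2\alpha)+z\bigl(P_1(\theta)-\lambda\bigr)+z^2(\theta+\gamma_1+\gamma_2)(\theta+2\gamma_1)(\theta+2\gamma_2),$$ where $$P_1(\theta)=-2\theta^3+3(\alpha-\gamma_1-\gamma_2)\theta^2+\bigl(4\alpha(\gamma_1+\gamma_2)-4\gamma_1\gamma_2-\alpha-\gamma_1-\gamma_2\bigr)\theta.$$ (b) The operator $L_\lambda$ is the symmetric square of a Gauss hypergeometric equation if and only if $$\lambda=\lambda_0:=2\gamma_1\gamma_2(1-2\alpha).$$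 (c) At $\lambda=\lambda_0$, the recovered Gauss parameters are $$a=\gamma_1,\qquad b=\gamma_2,\qquad c=1-\alpha,$$ and $L_{\lambda_0}=\operatorname{Sym}^2\bigl(\mathrm{Gauss}(a,b;c)\bigr)$.
   Context: $D=\frac{d}{dz}$, $\theta=zD$; parameters are complex numbers. The Riemann scheme lists the local exponents (roots of the indicial polynomials) of the operator at its singular points; the exponents $r$ at $\infty$ correspond to behaviour $z^{-r}$. The Euler form is $\widetilde L_\lambda=z^3(z-1)^2L_\lambda$, with $L_\lambda$ monic in $D$. $\mathrm{Gauss}(a,b;c)$ is the monic Gauss hypergeometric operator $$D^2+\Bigl(\frac{c}{z}+\frac{a+b+1-c}{z-1}\Bigr)D+\frac{ab}{z(z-1)}$$ of ${}_2F_1(a,b;c;z)$. The symmetric square of $M=D^2+pD+q$ is $$\operatorname{Sym}^2(M)=D^3+3p\,D^2+(2p^2+p'+4q)D+(4pq+2q').$$ *)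

(* Defs.v *)
From HB Require Import structures.
From mathcomp Require Import all_boot all_order all_algebra.
From mathcomp Require Import generic_quotient fraction ring.
From mathcomp Require Import reals.
From mathcomp.real_closed Require Import complex.

Set Implicit Arguments.
Unset Strict Implicit.
Unset Printing Implicit Defensive.

Import GRing.Theory.
Local Open Scope ring_scope.
Local Open Scope quotient_scope.

Notation "x %:F" := (@FracField.tofrac _ x) : ring_scope.
Notation ratfun K := {fraction {poly K}}.

(** [L : diffop K] stands for the operator [\sum_i L`_i D^i], where [D = d/dz]
    and the coefficients in [K(z)] are written to the left of the powers
    of [D].  The composition of operators is [opcomp] below, not the
    (commutative) product of polynomials; only the additive structure, left
    multiplication [f *: L] by functions, [size] and [\is monic] carry over. *)
Notation diffop K := {poly ratfun K}.

Section Operators.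
Variable K : fieldType.
Implicit Types (f : ratfun K) (A B L M : diffop K).

Definition zvar : ratfun K := ('X : {poly K})%:F.
Definition cst (c : K) : ratfun K := (c%:P)%:F.

(** Quotient rule on a chosen representative; [rderivE] shows that the choice
    is immaterial. *)
Definition rderiv f : ratfun K :=
  let n := (frac (repr f)).1 in
  let d := (frac (repr f)).2 in
  (n^`() * d - n * d^`())%:F / (d ^+ 2)%:F.

Lemma frac_reprE f : f = (frac (repr f)).1%:F / (frac (repr f)).2%:F.
Proof.
have d0 := denom_ratioP (repr f).
apply/(canRL (mulfK _)); first by rewrite tofrac_eq0.
set d := (frac (repr f)).2 in d0 *; set n := (frac (repr f)).1.
have -> : f = \pi_({fraction {poly K}}) (Ratio n d).
  by rewrite /n /d FracField.Ratio_numden reprK.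
unlock FracField.tofrac; rewrite -[LHS]FracField.pi_mul.
apply/eqP; rewrite FracField.equivf_def /FracField.mulf.
by rewrite /FracField.equivf !numden_Ratio ?mulf_neq0 ?oner_eq0 // !mulr1 mulrC.
Qed.

Lemma rderivE (p q : {poly K}) : q != 0 ->
  rderiv (p%:F / q%:F) = (p^`() * q - p * q^`())%:F / (q ^+ 2)%:F.
Proof.
move=> q0; rewrite /rderiv.
have := frac_reprE (p%:F / q%:F).
have := denom_ratioP (repr (p%:F / q%:F)).
set d := _.2; set n := _.1 => d0 /eqP.
rewrite eqr_div ?tofrac_eq0 // -!tofracM tofrac_eq => /eqP e.
have e' : p^`() * d + p * d^`() = n^`() * q + n * q^`() by rewrite -!derivM e.
apply/eqP; rewrite eqr_div ?tofrac_eq0 ?expf_neq0 // -!tofracM tofrac_eq.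
apply/eqP; symmetry.
have -> : (p^`() * q - p * q^`()) * d ^+ 2
  = (p^`() * d + p * d^`()) * (q * d) - p * d * (q * d^`() + q^`() * d) by ring.
by rewrite e' e; ring.
Qed.

(** [D b D^j = b' D^j + b D^(j+1)] *)
Definition opD L : diffop K := map_poly rderiv L + 'X * L.

Definition opcomp A B : diffop K := \sum_(i < size A) A`_i *: iter i opD B.

Definition theta : diffop K := zvar *: 'X.

Definition at_theta (P : {poly K}) : diffop K :=
  \sum_(i < size P) cst P`_i *: iter i (opcomp theta) 1.

Definition order L : nat := (size L).-1.

(** [f] is regular at the finite point [a], with value [v]. *)
Definition regular_value (a : K) f (v : K) : Prop :=
  exists p q : {poly K}, [/\ q.[a] != 0, f = p%:F / q%:F & v = p.[a] / q.[a]].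

(** [f] is regular at infinity, with value [v]. *)
Definition regular_value_infty f (v : K) : Prop :=
  exists p q : {poly K}, [/\ q != 0, (size p <= size q)%N, f = p%:F / q%:F
    & v = p`_(size q).-1 / lead_coef q].

(** [z^i D^i] acts on [z^r] as multiplication by [(falling i).[r]]. *)
Definition falling (k : nat) : {poly K} := \prod_(j < k) ('X - (j%:R)%:P).

(** For monic [L = D^n + p_1 D^(n-1) + ... + p_n], the functions
    [(z - a)^i p_i] and [z^i p_i]. *)
Definition scaled_coef (a : K) L (i : nat) : ratfun K :=
  (zvar - cst a) ^+ i * L`_(order L - i).
Definition scaled_coef_infty L (i : nat) : ratfun K :=
  zvar ^+ i * L`_(order L - i).

Definition ordinary_point (a : K) L : Prop :=
  forall i, (i < order L)%N -> exists v, regular_value a L`_i v.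

(** Fuchs' criterion for a point to be ordinary or a regular singularity. *)
Definition fuchsian_point (a : K) L : Prop :=
  forall i, (i <= order L)%N -> exists v, regular_value a (scaled_coef a L i) v.
Definition fuchsian_infty L : Prop :=
  forall i, (i <= order L)%N ->
    exists v, regular_value_infty (scaled_coef_infty L i) v.

(** The [s] below is the multiset of roots, with multiplicities, of the
    indicial polynomial: [L (z-a)^r = (z-a)^(r-n) (indicial(r) + o(1))] at a
    finite point and [L z^(-r) = z^(-r-n) (indicial(r) + o(1))] at infinity. *)
Definition exponents_at (a : K) L (s : seq K) : Prop :=
  exists b : nat -> K,
    (forall i, (i <= order L)%N -> regular_value a (scaled_coef a L i) (b i)) /\
    \sum_(i < (order L).+1) b i *: falling (order L - i)
      %= \prod_(e <- s) ('X - e%:P).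
Definition exponents_infty L (s : seq K) : Prop :=
  exists b : nat -> K,
    (forall i, (i <= order L)%N ->
       regular_value_infty (scaled_coef_infty L i) (b i)) /\
    \sum_(i < (order L).+1) b i *: (falling (order L - i) \Po (- 'X))
      %= \prod_(e <- s) ('X - e%:P).

(** Fuchsian on the projective line, with singular points among 0, 1 and
    infinity. *)
Definition fuchsian01oo L : Prop :=
  [/\ forall a : K, a != 0 -> a != 1 -> ordinary_point a L,
      fuchsian_point 0 L, fuchsian_point 1 L & fuchsian_infty L].

Definition riemann_scheme L (s0 s1 soo : seq K) : Prop :=
  [/\ exponents_at 0 L s0, exponents_at 1 L s1 & exponents_infty L soo].

Definition gauss (a b c : K) : diffop K :=
  'X^2
  + (cst c / zvar + cst (a + b + 1 - c) / (zvar - 1)) *: 'X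
  + (cst (a * b) / (zvar * (zvar - 1)))%:P.

(** For [M = D^2 + p D + q]. *)
Definition Sym2 M : diffop K :=
  let p := M`_1 in let q := M`_0 in
  'X^3 + (3%:R * p) *: 'X^2
  + (2%:R * p ^+ 2 + rderiv p + 4%:R * q) *: 'X
  + (4%:R * p * q + 2%:R * rderiv q)%:P.

Definition nonzero_int (x : K) : Prop := exists2 n : int, n != 0 & x = n%:~R.

Section Family.
Variables (alpha beta gamma1 gamma2 : K).

Definition P1 : {poly K} :=
  - 2%:R *: 'X^3
  + (3%:R * (alpha - gamma1 - gamma2)) *: 'X^2
  + (4%:R * alpha * (gamma1 + gamma2) - 4%:R * gamma1 * gamma2
     - alpha - gamma1 - gamma2) *: 'X.

Definition euler_form (lambda : K) : diffop K :=
  at_theta ('X * ('X - alpha%:P) * ('X - (2%:R * alpha)%:P))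
  + zvar *: at_theta (P1 - lambda%:P)
  + zvar ^+ 2 *: at_theta (('X + (gamma1 + gamma2)%:P)
                           * ('X + (2%:R * gamma1)%:P)
                           * ('X + (2%:R * gamma2)%:P)).

Definition lambda0 : K := 2%:R * gamma1 * gamma2 * (1 - 2%:R * alpha).

Definition genuine_order3 : Prop := forall lambda, order (euler_form lambda) = 3%N.

Definition generic_locus : Prop :=
  [/\ ~ nonzero_int alpha, ~ nonzero_int (2%:R * alpha),
      ~ nonzero_int beta, ~ nonzero_int (2%:R * beta)
    & ~ nonzero_int (gamma1 - gamma2)].

Definition has_scheme L : Prop :=
  [/\ L \is monic, order L = 3%N, fuchsian01oo L
    & riemann_scheme L [:: 0; alpha; 2%:R * alpha] [:: 0; beta; 2%:R * beta]
        [:: gamma1 + gamma2; 2%:R * gamma1; 2%:R * gamma2]].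

End Family.

End Operators.

(* Main.v *)
Require Import Defs.
From mathcomp Require Import all_boot all_order all_algebra.
From mathcomp Require Import fraction reals ring zify.
From mathcomp.real_closed Require Import complex.
Import GRing.Theory.
Local Open Scope ring_scope.

(** Put [w = z (z - 1)].  The order [n] operators that are Fuchsian with
    singular points among 0, 1 and infinity are exactly those of the form
    [\sum_i (Q_i / w^i) D^(n-i)] with [Q_0 = 1] and [Q_i] a polynomial of
    degree at most [i] ([fuchsian01ooP]): if [p_i] is the coefficient of
    [D^(n-i)], the conditions at finite points say that [w^i p_i] has no pole,
    hence is a polynomial since the field is algebraically closed, and the
    condition at infinity bounds its degree.

    In this form the Riemann scheme is a system of linear equations for the
    [Q_i]: the exponents at 0, 1 and infinity prescribe respectively [Q_i(0)],
    [Q_i(1)] and the coefficient of [z^i] in [Q_i].  For [n = 3] these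
    overdetermine [Q_1], consistently because of
    [alpha + beta + gamma1 + gamma2 = 1], determine [Q_2], and leave one
    coefficient of [Q_3] free; this coefficient is the accessory parameter
    ([riemann_schemeP]).  The operators obtained, called [family] below, depend
    on [alpha], [s = gamma1 + gamma2], [m = gamma1 * gamma2] and [lambda] only,
    and their Euler form is found by expanding the powers of [theta]
    ([euler_formE]).

    For all [a], [b] and [c], the symmetric square of the Gauss operator is the
    member of such a family with [alpha = 1 - c], [s = a + b], [m = a b] and
    [lambda = 2 m (1 - 2 alpha)] ([Sym2_gauss]).  As a member of a family
    determines all of [alpha], [s], [m] and [lambda] ([family_inj]), a
    coincidence of [L_lambda] with a symmetric square forces [lambda] to be
    [lambda0], and recovers [c], [a + b] and [a b], thus [a] and [b] up to
    exchange. *)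

Set Implicit Arguments.
Unset Strict Implicit.
Unset Printing Implicit Defensive.

(** * Regular values of rational functions *)

Section RationalFunctions.
Variable K : fieldType.
Implicit Types (a v : K) (f g : ratfun K) (p q : {poly K}).

Lemma regular_value_uniq a f v w :
  regular_value a f v -> regular_value a f w -> v = w.
Proof.
move=> [p [q [qa -> ->]]] [p' [q' [qa' /eqP e ->]]]; move: e.
have q0 : q != 0 by apply: contraNneq qa => ->; rewrite horner0.
have q0' : q' != 0 by apply: contraNneq qa' => ->; rewrite horner0.
rewrite eqr_div ?tofrac_eq0 // -!tofracM tofrac_eq => /eqP e.
by apply/eqP; rewrite eqr_div // -!hornerM e.
Qed.

(** Needed at infinity, where values are ratios of coefficients at the degree
    of the denominator: these may vanish in the numerator, so they need not be
    leading coefficients. *)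
Lemma coefM_top m n p q : (size p <= m.+1)%N -> (size q <= n.+1)%N ->
  (p * q)`_(m + n) = p`_m * q`_n.
Proof.
move=> sp sq; have lm : (m < (m + n).+1)%N by rewrite ltnS leq_addr.
rewrite coefM (bigD1 (Ordinal lm)) //= addKn big1 ?addr0 // => i.
rewrite -val_eqE /= neq_ltn => /orP[lt_im|lt_mi].
  by rewrite [q`__]nth_default ?mulr0 // (leq_trans sq) // ltn_subRL ltn_add2r.
by rewrite nth_default ?mul0r // (leq_trans sp).
Qed.

Lemma regular_value_infty_uniq f v w :
  regular_value_infty f v -> regular_value_infty f w -> v = w.
Proof.
move=> [p [q [q0 sp -> ->]]] [p' [q' [q0' sp' /eqP e ->]]]; move: e.
rewrite eqr_div ?tofrac_eq0 // -!tofracM tofrac_eq => /eqP e.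
have top (r : {poly K}) : r != 0 -> (size r <= (size r).-1.+1)%N.
  by move=> r0; rewrite -polySpred.
apply/eqP; rewrite eqr_div ?lead_coef_eq0 // /lead_coef.
rewrite -!coefM_top ?top -?polySpred //.
by rewrite e addnC.
Qed.

Lemma regular_valueM a f p v : regular_value a f v ->
  regular_value a (f * p%:F) (v * p.[a]).
Proof.
move=> [n [d [da -> ->]]]; exists (n * p), d; split=> //.
  by rewrite tofracM mulrAC.
by rewrite hornerM mulrAC.
Qed.

Lemma rderiv_tofrac p : rderiv p%:F = p^`()%:F.
Proof.
have := @rderivE K p 1 (oner_neq0 _).
by rewrite tofrac1 divr1 derivC mulr0 subr0 mulr1 expr1n tofrac1 divr1.
Qed.

Lemma rderiv0 : rderiv 0 = 0 :> ratfun K.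
Proof. by rewrite -[X in rderiv X]tofrac0 rderiv_tofrac deriv0 tofrac0. Qed.

Lemma X_sub1_neq0 : 'X - 1 != 0 :> {poly K}.
Proof. by rewrite -polyC1 polyXsubC_eq0. Qed.

Lemma zvar_neq0 : zvar K != 0.
Proof. by rewrite tofrac_eq0 polyX_eq0. Qed.

Lemma zvar_sub1E : zvar K - 1 = ('X - 1)%:F.
Proof. by rewrite tofracB tofrac1. Qed.

Lemma zvar_sub1_neq0 : zvar K - 1 != 0.
Proof. by rewrite zvar_sub1E tofrac_eq0 X_sub1_neq0. Qed.

(** * Fuchsian operators with singular points 0, 1 and infinity *)

(** [Q i] is the numerator of the coefficient of [D^(n-i)], so that its index
    is both the order of the pole and the bound on its degree. *)
Definition fuchs_op n (Q : nat -> {poly K}) : diffop K :=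
  \poly_(i < n.+1) ((Q (n - i)%N)%:F / (zvar K * (zvar K - 1)) ^+ (n - i)).

Lemma fuchs_op_coef n Q i : (i <= n)%N ->
  (fuchs_op n Q)`_(n - i) = (Q i)%:F / (zvar K * (zvar K - 1)) ^+ i.
Proof. by move=> le_in; rewrite coef_poly ltnS leq_subr subKn. Qed.

Lemma fuchs_op_inj n Q Q' : fuchs_op n Q = fuchs_op n Q' ->
  forall i, (i <= n)%N -> Q i = Q' i.
Proof.
move=> e i le_in; have := fuchs_op_coef Q le_in.
rewrite e fuchs_op_coef // => /mulIf/eqP.
rewrite invr_eq0 expf_eq0 mulf_eq0 (negPf zvar_neq0) (negPf zvar_sub1_neq0) andbF.
by move=> /(_ isT); rewrite tofrac_eq => /eqP.
Qed.

Lemma eq_fuchs_op n Q Q' : (forall i, (i <= n)%N -> Q i = Q' i) ->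
  fuchs_op n Q = fuchs_op n Q'.
Proof.
move=> e; apply/polyP=> i; rewrite !coef_poly; case: ifP => // _.
by rewrite e ?leq_subr.
Qed.

Section Fuchs.
Variables (n : nat) (Q : nat -> {poly K}).
Hypothesis Q0 : Q 0%N = 1.
Let L := fuchs_op n Q.

Lemma fuchs_op_lead : L`_n = 1.
Proof.
by rewrite -{1}(subn0 n) fuchs_op_coef // Q0 tofrac1 expr0 divr1.
Qed.

Lemma size_fuchs_op : size L = n.+1.
Proof.
apply/eqP; rewrite eqn_leq size_poly /= ltnNge; apply/negP=> le_n.
by move: (oner_neq0 (ratfun K)); rewrite -fuchs_op_lead nth_default ?eqxx.
Qed.

Lemma fuchs_op_monic : L \is monic.
Proof. by rewrite monicE lead_coefE size_fuchs_op fuchs_op_lead. Qed.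

Lemma order_fuchs_op : Defs.order L = n.
Proof. by rewrite /Defs.order size_fuchs_op. Qed.

Lemma scaled_coef0 i : (i <= n)%N ->
  scaled_coef 0 L i = (Q i)%:F / (('X - 1) ^+ i)%:F.
Proof.
move=> le_in; rewrite /scaled_coef order_fuchs_op fuchs_op_coef //.
rewrite /cst polyC0 tofrac0 subr0 exprMn tofracXn -zvar_sub1E.
by rewrite invfM mulrCA mulVKf // expf_neq0 // zvar_neq0.
Qed.

Lemma scaled_coef1 i : (i <= n)%N ->
  scaled_coef 1 L i = (Q i)%:F / ('X ^+ i)%:F.
Proof.
move=> le_in; rewrite /scaled_coef order_fuchs_op fuchs_op_coef //.
rewrite /cst polyC1 tofrac1 exprMn tofracXn.
rewrite [in RHS]/('X%:F) -/(zvar K) mulrC -mulrA; congr (_ * _).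
by rewrite invfM mulfVK // expf_neq0 // zvar_sub1_neq0.
Qed.

Lemma scaled_coef_oo i : (i <= n)%N ->
  scaled_coef_infty L i = (Q i)%:F / (('X - 1) ^+ i)%:F.
Proof.
move=> le_in; rewrite -scaled_coef0 //.
by rewrite /scaled_coef /cst polyC0 tofrac0 subr0.
Qed.

Lemma fuchs_op_value0 i : (i <= n)%N ->
  regular_value 0 (scaled_coef 0 L i) ((-1) ^+ i * (Q i).[0]).
Proof.
move=> le_in; exists (Q i), (('X - 1) ^+ i); rewrite scaled_coef0 //.
have e : (('X - 1) ^+ i).[0] = (-1) ^+ i :> K.
  by rewrite horner_exp -polyC1 hornerXsubC sub0r.
split=> //; rewrite e ?signr_eq0 //.
by rewrite mulrC -exprVn invrN invr1.
Qed.

Lemma fuchs_op_value1 i : (i <= n)%N ->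
  regular_value 1 (scaled_coef 1 L i) (Q i).[1].
Proof.
move=> le_in; exists (Q i), ('X^i); rewrite scaled_coef1 //.
by split; rewrite // hornerXn expr1n ?oner_neq0 ?divr1.
Qed.

Lemma size_X_sub1_exp i : size (('X - 1) ^+ i : {poly K}) = i.+1.
Proof. by rewrite -polyC1 size_exp_XsubC. Qed.

Lemma fuchs_op_value_oo i : (i <= n)%N -> (size (Q i) <= i.+1)%N ->
  regular_value_infty (scaled_coef_infty L i) (Q i)`_i.
Proof.
move=> le_in sQ; exists (Q i), (('X - 1) ^+ i); rewrite scaled_coef_oo //.
split=> //; rewrite ?size_X_sub1_exp ?expf_neq0 ?X_sub1_neq0 //=.
by rewrite lead_coef_exp -polyC1 lead_coefXsubC expr1n divr1.
Qed.

(** Multiplying [p_i] by [z^i] leaves [Q_i / (z - 1)^i], whose denominator has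
    degree [i]. *)
Lemma fuchs_op_oo_size i v : (i <= n)%N ->
  regular_value_infty (scaled_coef_infty L i) v -> (size (Q i) <= i.+1)%N.
Proof.
move=> le_in; rewrite scaled_coef_oo // => -[p [q [q0 sp /eqP]]].
have E0 : ('X - 1) ^+ i != 0 :> {poly K} by rewrite expf_neq0 // X_sub1_neq0.
rewrite eqr_div ?tofrac_eq0 // -!tofracM tofrac_eq => /eqP e _.
have [->|Qi0] := eqVneq (Q i) 0; first by rewrite size_poly0.
have p0 : p != 0.
  by apply: contraTneq (mulf_neq0 Qi0 q0) => p0; rewrite e p0 mul0r eqxx.
have := congr1 (fun r : {poly K} => size r) e.
rewrite !size_mul // size_X_sub1_exp addnS /= => es.
have q1 : (0 < size q)%N by rewrite size_poly_gt0.
by move: (size (Q i)) (size p) (size q) es sp q1; lia.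
Qed.
End Fuchs.

End RationalFunctions.

Section ClosedField.
Variable K : closedFieldType.

(** A root of the denominator of a fraction that is regular there must also be
    a root of the numerator; cancelling the common factor lowers the degree of
    the denominator until it is constant. *)
Lemma regular_poly (f : ratfun K) :
  (forall a, exists v, regular_value a f v) -> exists p, f = p%:F.
Proof.
move=> reg; rewrite (frac_reprE f) in reg *.
have := denom_ratioP (repr f).
move: (frac (repr f)).1 (frac (repr f)).2 reg => n d.
have [m] := ubnP (size d); elim: m n d => // m IH n d lt_dm reg d0.
have [d1|] := eqVneq (size d) 1%N.
  have /size_poly1P[c c0 ->] : size d == 1%N by rewrite d1.
  exists (c^-1 *: n); rewrite -mul_polyC tofracM mulrC; congr (_ * _).
  rewrite -[LHS]mul1r; apply: (canLR (mulfK _)); first by rewrite tofrac_eq0 polyC_eq0.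
  by rewrite -tofracM -polyCM mulVf // tofrac1.
move/closed_rootP => [a /[dup] da /factor_theorem[d' dE]].
have d'0 : d' != 0 by apply: contraNneq d0 => d'0; rewrite dE d'0 mul0r.
have XaF : ('X - a%:P)%:F != 0 :> ratfun K by rewrite tofrac_eq0 polyXsubC_eq0.
have /factor_theorem[n' nE] : root n a.
  have [v [p [q [qa /eqP + _]]]] := reg a.
  have q0 : q != 0 by apply: contraNneq qa => ->; rewrite horner0.
  rewrite eqr_div ?tofrac_eq0 // -!tofracM tofrac_eq => /eqP e.
  have := congr1 (horner^~ a) e; rewrite !hornerM (rootP da) mulr0 => /eqP.
  by rewrite mulf_eq0 (negPf qa) orbF.
have fE : n%:F / d%:F = n'%:F / d'%:F.
  by rewrite nE dE !tofracM invfM mulrACA divff // mulr1.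
rewrite fE in reg *; apply: IH => //.
by move: lt_dm; rewrite dE size_Mmonic ?monicXsubC // size_XsubC addn2.
Qed.

(** The numerators are [Q_i = w^i p_i]: at 0 and 1 one of the two factors of [w]
    compensates the pole while the other is harmless. *)
Lemma fuchsian01ooP n (L : diffop K) : L \is monic -> Defs.order L = n ->
  fuchsian01oo L <->
  exists Q : nat -> {poly K},
    [/\ Q 0%N = 1, forall i, (i <= n)%N -> (size (Q i) <= i.+1)%N
      & L = fuchs_op n Q].
Proof.
move=> monL ordL; split.
  case=> ord r0 r1 roo.
  have sL : size L = n.+1 by rewrite -ordL /Defs.order prednK // size_poly_gt0 monic_neq0.
  pose w := zvar K * (zvar K - 1).
  have w0 : w != 0 by rewrite mulf_neq0 ?zvar_neq0 ?zvar_sub1_neq0.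
  have poly_coef i : exists q, (i <= n)%N -> L`_(n - i) * w ^+ i = q%:F.
    case: (leqP i n) => [le_in|_]; last by exists 0.
    suff /regular_poly[q qE] :
        forall a, exists v, regular_value a (L`_(n - i) * w ^+ i) v by exists q.
    move=> a.
    have [->|a0] := eqVneq a 0.
      have := r0 i; rewrite ordL => /(_ le_in)[v].
      rewrite /scaled_coef ordL /cst polyC0 tofrac0 subr0.
      move=> /(regular_valueM (('X - 1) ^+ i)); set x := _ * _ => rv.
      exists (v * (('X - 1) ^+ i).[0]); suff -> : L`_(n - i) * w ^+ i = x by [].
      by rewrite /x /w tofracXn -zvar_sub1E exprMn mulrCA mulrA.
    have [->|a1] := eqVneq a 1.
      have := r1 i; rewrite ordL => /(_ le_in)[v].
      rewrite /scaled_coef ordL /cst polyC1 tofrac1.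
      move=> /(regular_valueM ('X ^+ i)); set x := _ * _ => rv.
      exists (v * ('X ^+ i).[1]); suff -> : L`_(n - i) * w ^+ i = x by [].
      by rewrite /x /w tofracXn -/(zvar K) exprMn [LHS]mulrC -mulrA [RHS]mulrC.
    have [v rv] : exists v, regular_value a L`_(n - i) v.
      case: i le_in => [_|i lt_in]; last first.
        by apply: ord => //; rewrite ordL ltn_subrL (leq_ltn_trans _ lt_in).
      exists 1; exists 1, 1; rewrite hornerC oner_neq0 divr1 tofrac1 divr1 subn0.
      by move/monicP: monL; rewrite lead_coefE sL.
    exists (v * (('X * ('X - 1)) ^+ i).[a]).
    by rewrite /w zvar_sub1E -tofracM -tofracXn; apply: regular_valueM.
  have /fin_all_exists[Q0 Q0E] (i : 'I_n.+1) :
      exists q, L`_(n - i) * w ^+ i = q%:F.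
    by have [q qE] := poly_coef i; exists q; apply: qE; rewrite -ltnS.
  have [Q QE] : exists Q : nat -> {poly K},
      forall i, (i <= n)%N -> L`_(n - i) * w ^+ i = (Q i)%:F.
    by exists (fun i => Q0 (inord i)) => i le_in; rewrite -Q0E inordK.
  have LE : L = fuchs_op n Q.
    apply/polyP=> i; rewrite coef_poly; case: ltnP => [lt_in|]; last first.
      by move=> le_ni; rewrite nth_default ?sL.
    rewrite -/w -(QE _ (leq_subr i n)).
    rewrite (subKn (ltnSE lt_in)).
    by rewrite (mulfK (expf_neq0 _ w0)).
  have Q01 : Q 0%N = 1.
    apply/eqP; rewrite -(@tofrac_eq {poly K}) -(QE _ (leq0n _)) subn0 expr0 mulr1 tofrac1.
    by move: monL; rewrite monicE lead_coefE sL.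
  exists Q; split=> // i le_in; have := roo i; rewrite ordL => /(_ le_in)[v].
  by rewrite LE; apply: fuchs_op_oo_size.
move=> [Q [Q0 sQ ->]]; rewrite /fuchsian01oo /fuchsian_point /fuchsian_infty.
split.
- move=> a a0 a1 i; rewrite order_fuchs_op // => lt_in.
  rewrite -(subKn (ltnW lt_in)) fuchs_op_coef ?leq_subr //.
  exists ((Q (n - i)%N).[a] / (('X * ('X - 1)) ^+ (n - i)).[a]).
  exists (Q (n - i)%N), (('X * ('X - 1)) ^+ (n - i)).
  rewrite zvar_sub1E -tofracM tofracXn; split=> //.
  rewrite horner_exp hornerM hornerX -polyC1 hornerXsubC expf_neq0 // mulf_neq0 //.
  by rewrite subr_eq0.
- by move=> i; rewrite order_fuchs_op // => le_in; eexists; apply: fuchs_op_value0.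
- by move=> i; rewrite order_fuchs_op // => le_in; eexists; apply: fuchs_op_value1.
- move=> i; rewrite order_fuchs_op // => le_in.
  by eexists; apply: fuchs_op_value_oo; rewrite ?sQ.
Qed.

End ClosedField.

(** * Exponents in terms of the numerators *)

Section Indicial.
Variable K : fieldType.
Implicit Types (Q : nat -> {poly K}) (s : seq K).

(** The sign is the value at 0 of the cofactor [(z - 1)^i]. *)
Lemma exponents_at0_fuchs_op n Q s : Q 0%N = 1 ->
  exponents_at 0 (fuchs_op n Q) s <->
  \sum_(i < n.+1) ((-1) ^+ i * (Q i).[0]) *: falling K (n - i)
    %= \prod_(e <- s) ('X - e%:P).
Proof.
move=> Q0; rewrite /exponents_at order_fuchs_op //; split.
  move=> [b [vb eqb]]; rewrite (eq_bigr (fun i : 'I_n.+1 => b i *: falling K (n - i))) //.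
  move=> i _; congr (_ *: _); have le_in := ltnSE (ltn_ord i).
  exact: regular_value_uniq (fuchs_op_value0 Q0 le_in) (vb _ le_in).
by move=> eqs; eexists; split=> [i le_in|]; [exact: fuchs_op_value0 | exact: eqs].
Qed.

Lemma exponents_at1_fuchs_op n Q s : Q 0%N = 1 ->
  exponents_at 1 (fuchs_op n Q) s <->
  \sum_(i < n.+1) (Q i).[1] *: falling K (n - i)
    %= \prod_(e <- s) ('X - e%:P).
Proof.
move=> Q0; rewrite /exponents_at order_fuchs_op //; split.
  move=> [b [vb eqb]]; rewrite (eq_bigr (fun i : 'I_n.+1 => b i *: falling K (n - i))) //.
  move=> i _; congr (_ *: _); have le_in := ltnSE (ltn_ord i).
  exact: regular_value_uniq (fuchs_op_value1 Q0 le_in) (vb _ le_in).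
by move=> eqs; eexists; split=> [i le_in|]; [exact: fuchs_op_value1 | exact: eqs].
Qed.

Lemma eqp_comp_polyNX (p q : {poly K}) :
  (p \Po (- 'X) %= q) = (p %= q \Po (- 'X)).
Proof.
have NXK (r : {poly K}) : (r \Po (- 'X)) \Po (- 'X) = r.
  by rewrite -comp_polyA linearN /= comp_polyX opprK comp_polyXr.
have hom (r t : {poly K}) : r %= t -> r \Po (- 'X) %= t \Po (- 'X).
  by move=> /andP[rt tr]; rewrite /eqp !dvdp_comp_poly.
by apply/idP/idP => /hom; rewrite NXK.
Qed.

Lemma prod_XsubC_compNX s :
  (\prod_(e <- s) ('X - e%:P)) \Po (- 'X) %= \prod_(e <- [seq - e | e <- s]) ('X - e%:P).
Proof.
elim: s => [|e s IH]; first by rewrite /= !big_nil comp_polyC eqpxx.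
rewrite /= !big_cons comp_polyM.
apply: eqp_trans (eqp_mull _ IH) _; apply: eqp_mulr.
rewrite comp_polyB comp_polyX comp_polyC polyCN opprK -opprD.
by rewrite -scaleN1r eqp_scale // oppr_eq0 oner_eq0.
Qed.

(** Substituting [-'X] turns the indicial polynomial at infinity into that of a
    finite point, at the cost of negating the exponents; all three points are
    then covered by [cubic_indicialP]. *)
Lemma exponents_infty_fuchs_op n Q s : Q 0%N = 1 ->
  (forall i, (i <= n)%N -> (size (Q i) <= i.+1)%N) ->
  exponents_infty (fuchs_op n Q) s <->
  \sum_(i < n.+1) (Q i)`_i *: falling K (n - i)
    %= \prod_(e <- [seq - e | e <- s]) ('X - e%:P).
Proof.
move=> Q0 sQ; rewrite /exponents_infty order_fuchs_op //.
have flip (b : nat -> K) :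
    (\sum_(i < n.+1) b i *: (falling K (n - i) \Po (- 'X))
       %= \prod_(e <- s) ('X - e%:P))
    = (\sum_(i < n.+1) b i *: falling K (n - i)
       %= \prod_(e <- [seq - e | e <- s]) ('X - e%:P)).
  rewrite -(eqp_rtrans (prod_XsubC_compNX s)) -eqp_comp_polyNX linear_sum /=.
  by under [in RHS]eq_bigr do rewrite linearZ.
split=> [[b [vb]] | eqs].
  rewrite flip => eqb.
  rewrite (eq_bigr (fun i : 'I_n.+1 => b i *: falling K (n - i))) //.
  move=> i _; congr (_ *: _); have le_in := ltnSE (ltn_ord i).
  exact: regular_value_infty_uniq (fuchs_op_value_oo Q0 le_in (sQ _ le_in)) (vb _ le_in).
exists (fun i => (Q i)`_i); rewrite (flip (fun i => (Q i)`_i)); split=> // i le_in.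
by apply: fuchs_op_value_oo => //; apply: sQ.
Qed.

Lemma cubic_inj (a b c a' b' c' : K) :
  'X^3 + a *: 'X^2 + b *: 'X + c%:P = 'X^3 + a' *: 'X^2 + b' *: 'X + c'%:P ->
  [/\ a = a', b = b' & c = c'].
Proof.
move=> e; have co i := congr1 (fun p : {poly K} => p`_i) e.
move: (co 0%N) (co 1%N) (co 2%N).
by rewrite !(coefD, coefZ, coefXn, coefX, coefC) /= !(mulr0, mulr1, addr0, add0r).
Qed.

Lemma monic_cubic (a b c : K) : 'X^3 + a *: 'X^2 + b *: 'X + c%:P \is monic.
Proof.
suff -> : 'X^3 + a *: 'X^2 + b *: 'X + c%:P = Poly [:: c; b; a; 1].
  by rewrite monicE lead_coefE (@PolyK _ 0) ?oner_neq0.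
apply/polyP=> -[|[|[|[|i]]]];
  rewrite coef_Poly !(coefD, coefZ, coefXn, coefX, coefC) /=;
  by rewrite ?nth_nil !(mulr0, mulr1, addr0, add0r).
Qed.

Lemma cubic_indicialP (b : nat -> K) (e0 e1 e2 : K) : b 0%N = 1 ->
  (\sum_(i < 4) b i *: falling K (3 - i)
     %= \prod_(e <- [:: e0; e1; e2]) ('X - e%:P)) <->
  [/\ b 1%N = 3%:R - (e0 + e1 + e2),
      b 2%N = 1 - (e0 + e1 + e2) + (e0 * e1 + e0 * e2 + e1 * e2)
    & b 3%N = - (e0 * e1 * e2)].
Proof.
move=> b0.
have -> : \prod_(e <- [:: e0; e1; e2]) ('X - e%:P)
    = 'X^3 + (- (e0 + e1 + e2)) *: 'X^2
      + (e0 * e1 + e0 * e2 + e1 * e2) *: 'X + (- (e0 * e1 * e2))%:P.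
  by rewrite !big_cons big_nil -!mul_polyC; ring.
have -> : \sum_(i < 4) b i *: falling K (3 - i)
    = 'X^3 + (b 1%N - 3%:R) *: 'X^2 + (b 2%N - b 1%N + 2%:R) *: 'X + (b 3%N)%:P.
  rewrite !big_ord_recl big_ord0 /= b0 /falling.
  rewrite !subSS !subn0 !big_ord_recr !big_ord0 /= -!mul_polyC.
  by ring.
rewrite eqp_monic ?monic_cubic //; split.
  move=> /eqP/cubic_inj[h1 h2 h3]; split=> //.
    by rewrite -[b 1%N](subrK 3%:R) h1; ring.
  by rewrite -[b 2%N](addrK (- b 1%N + 2%:R)) addrA h2 -[b 1%N](subrK 3%:R) h1; ring.
by move=> [-> -> ->]; apply/eqP; rewrite -!mul_polyC; ring.
Qed.

End Indicial.

(** * Identities between third order operators *)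

Lemma at_theta_id (F : comNzRingType) (z a3 a2 a1 a0 : F) :
  0 + a0 *: 1 + a1 *: (z *: 'X) + a2 *: (z ^+ 2 *: 'X^2 + z *: 'X)
    + a3 *: (z ^+ 3 *: 'X^3 + (3%:R * z ^+ 2) *: 'X^2 + z *: 'X)
  = (a3 * z ^+ 3) *: 'X^3
    + ((3%:R * a3 + a2) * z ^+ 2) *: 'X^2
    + ((a3 + a2 + a1) * z) *: 'X + a0%:P.
Proof. by rewrite -!mul_polyC; ring. Qed.

(** With [f] in the role of the embedding of the constants in the rational
    functions, and [z] in that of the variable, the identities between
    operators become identities of rational expressions in [z] and the images
    of the parameters, which normalization in an abstract field settles. *)
Section Identities.
Variables (K F : fieldType) (f : {rmorphism K -> F}) (z : F).
Hypotheses (z0 : z != 0) (z1 : z - 1 != 0).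

(** The value of [family] when [z] stands for the variable. *)
Definition family_at (al s m la : K) : {poly F} :=
  'X^3 + ((f (3%:R * (1 + s)) * z + f (- 3%:R * (1 - al))) / (z * (z - 1))) *: 'X^2
  + ((f (1 + 3%:R * s + 2%:R * s ^+ 2 + 4%:R * m) * z ^+ 2
      + f (2%:R * al - 4%:R * s + 4%:R * al * s - 4%:R * m - 2%:R) * z
      + f ((1 - al) * (1 - 2%:R * al))) / (z * (z - 1)) ^+ 2) *: 'X
  + ((f (4%:R * s * m) * z ^+ 3 + f (- (la + 4%:R * s * m)) * z ^+ 2 + f la * z)
      / (z * (z - 1)) ^+ 3)%:P.

(** The cubic [a3 theta^3 + a2 theta^2 + a1 theta + a0], with powers of [theta]
    expanded as [theta^2 = z^2 D^2 + z D] and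
    [theta^3 = z^3 D^3 + 3 z^2 D^2 + z D]. *)
Definition theta_cubic (a3 a2 a1 a0 : K) : {poly F} :=
 (f a3 * z ^+ 3) *: 'X^3
    + ((3%:R * f a3 + f a2) * z ^+ 2) *: 'X^2
    + ((f a3 + f a2 + f a1) * z) *: 'X + (f a0)%:P.

Lemma euler_id (al s m la : K) :
  (z ^+ 3 * (z - 1) ^+ 2) *: family_at al s m la =
  theta_cubic 1 (- 3%:R * al) (2%:R * al ^+ 2) 0
  + z *: theta_cubic (- 2%:R) (3%:R * (al - s)) (4%:R * al * s - 4%:R * m - al - s) (- la)
  + z ^+ 2 *: theta_cubic 1 (3%:R * s) (2%:R * s ^+ 2 + 4%:R * m) (4%:R * s * m).
Proof.
rewrite /family_at /theta_cubic !scalerDr !scalerA.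
apply/polyP=> i; rewrite !(coefD, coefZ, coefX, coefXn, coefC).
case: i => [|[|[|[|i]]]] /=; rewrite ?(mulr0, mulr1, addr0, add0r).
all: by field; rewrite ?z0 ?z1.
Qed.

Lemma partial_fractions (c d : K) :
  f c / z + f d / (z - 1) = (f (c + d) * z - f c) / (z * (z - 1)).
Proof. by field; rewrite ?z0 ?z1. Qed.

(** Here [p] and [q] are the coefficients of the Gauss operator, and [p'], [q']
    their derivatives by the quotient rule. *)
Lemma gauss_id (a b c : K) :
  let d := a + b + 1 - c in
  let p := (f (c + d) * z - f c) / (z * (z - 1)) in
  let p' := (f (c + d) * (z * (z - 1)) - (f (c + d) * z - f c) * (2%:R * z - 1))
            / (z * (z - 1)) ^+ 2 in
  let q := f (a * b) / (z * (z - 1)) in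
  let q' := - f (a * b) * (2%:R * z - 1) / (z * (z - 1)) ^+ 2 in
  'X^3 + (3%:R * p) *: 'X^2
  + (2%:R * p ^+ 2 + p' + 4%:R * q) *: 'X
  + (4%:R * p * q + 2%:R * q')%:P
  = family_at (1 - c) (a + b) (a * b) (2%:R * (a * b) * (1 - 2%:R * (1 - c))).
Proof.
move=> d p p' q q'; rewrite /family_at.
congr ('X^3 + _ *: _ + _ *: _ + _%:P); rewrite /q' /p' /q /p /d;
 by field; rewrite ?z0 ?z1.
Qed.
End Identities.

(** * The family with the given Riemann scheme *)

(** The entry of index [i] is [Q_i].  The last one is
    [z (z - 1) (4 s m z - lambda)]: the exponent 0 occurs at both 0 and 1. *)
Definition family_coef (K : fieldType) (alpha s m lambda : K) : nat -> {poly K} :=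
  nth 0 [:: 1;
    (3%:R * (1 + s)) *: 'X + (- 3%:R * (1 - alpha))%:P;
    (1 + 3%:R * s + 2%:R * s ^+ 2 + 4%:R * m) *: 'X^2
      + (2%:R * alpha - 4%:R * s + 4%:R * alpha * s - 4%:R * m - 2%:R) *: 'X
      + ((1 - alpha) * (1 - 2%:R * alpha))%:P;
    (4%:R * s * m) *: 'X^3 + (- (lambda + 4%:R * s * m)) *: 'X^2 + lambda *: 'X].

Definition family (K : fieldType) (alpha s m lambda : K) : diffop K :=
  fuchs_op 3 (family_coef alpha s m lambda).

Section Scheme.
Variable K : closedFieldType.

Lemma size_family_coef (alpha s m lambda : K) i : (i <= 3)%N ->
  (size (family_coef alpha s m lambda i) <= i.+1)%N.
Proof.
move=> le_i3; apply/leq_sizeP=> j.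
move: i le_i3 j => [|[|[|[|]]]] //= _ [|[|[|[|j]]]] //= _;
  by rewrite !(coefD, coefN, coefZ, coefXn, coefX, coefC) /= ?(mulr0, addr0).
Qed.

Lemma size_le_expand n (p : {poly K}) : (size p <= n)%N ->
  p = \sum_(i < n) p`_i *: 'X^i.
Proof.
move=> sp; rewrite -poly_def; apply/polyP=> i; rewrite coef_poly.
by case: ltnP => // le_ni; rewrite nth_default // (leq_trans sp).
Qed.

Variables (alpha beta gamma1 gamma2 : K).
Hypothesis fuchs : alpha + beta + gamma1 + gamma2 = 1.
Let s := gamma1 + gamma2.
Let m := gamma1 * gamma2.

(** The two coefficients of [Q_1] are subject to three equations, which [fuchs]
    makes compatible; the four of [Q_3] are subject to three, which leave
    [lambda]. *)
Lemma riemann_schemeP (Q : nat -> {poly K}) : Q 0%N = 1 ->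
  (forall i, (i <= 3)%N -> (size (Q i) <= i.+1)%N) ->
  riemann_scheme (fuchs_op 3 Q) [:: 0; alpha; 2%:R * alpha]
    [:: 0; beta; 2%:R * beta] [:: gamma1 + gamma2; 2%:R * gamma1; 2%:R * gamma2]
  <-> exists lambda, forall i, (i <= 3)%N -> Q i = family_coef alpha s m lambda i.
Proof.
move=> Q0 sQ.
have betaE : beta = 1 - alpha - gamma1 - gamma2 by rewrite -fuchs; ring.
rewrite /riemann_scheme.
have ind0 := @cubic_indicialP _ (fun i => (-1) ^+ i * (Q i).[0]) 0 alpha (2%:R * alpha).
have ind1 := @cubic_indicialP _ (fun i => (Q i).[1]) 0 beta (2%:R * beta).
have indoo := @cubic_indicialP _ (fun i => (Q i)`_i)
  (- (gamma1 + gamma2)) (- (2%:R * gamma1)) (- (2%:R * gamma2)).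
have {ind0} ind0 := iff_trans (exponents_at0_fuchs_op 3 [:: 0; alpha; 2%:R * alpha] Q0)
  (ind0 ltac:(by rewrite expr0 mul1r Q0 hornerC)).
have {ind1} ind1 := iff_trans (exponents_at1_fuchs_op 3 [:: 0; beta; 2%:R * beta] Q0)
  (ind1 ltac:(by rewrite Q0 hornerC)).
have {indoo} indoo := iff_trans
  (exponents_infty_fuchs_op [:: gamma1 + gamma2; 2%:R * gamma1; 2%:R * gamma2] Q0 sQ)
  (indoo ltac:(by rewrite Q0 coefC)).
split.
  move=> [/ind0[z1 z2 z3] /ind1[o1 o2 o3] /indoo[i1 i2 i3]].
  exists (Q 3%N)`_1 => i le_i3.
  have E1 := size_le_expand (sQ 1%N isT).
  have E2 := size_le_expand (sQ 2%N isT).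
  have E3 := size_le_expand (sQ 3%N isT).
  move: z1 z2 z3 o1 o2 o3 i1 i2 i3.
  rewrite !horner_coef0.
  have horner1 n (p : {poly K}) : (size p <= n)%N -> p.[1] = \sum_(i < n) p`_i.
    move=> sp; rewrite (horner_coef_wide _ sp).
    by apply: eq_bigr => j _; rewrite expr1n mulr1.
  rewrite (horner1 _ _ (sQ 1%N isT)) (horner1 _ _ (sQ 2%N isT)).
  rewrite (horner1 _ _ (sQ 3%N isT)).
  rewrite !big_ord_recl !big_ord0 /= !/bump /= !add1n in E1 E2 E3 *.
  have sgn k (x y : K) : (-1) ^+ k * x = y -> x = (-1) ^+ k * y.
    by move=> <-; rewrite signrMK.
  move=> /sgn z1 /sgn z2 /sgn z3 _ o2 o3 i1 i2 i3.
  (* The middle coefficients are what remains of the values at 1. *)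
  have {o2} o2 := canRL (addrK _) (canRL (addKr _) o2).
  have {o3} o3 := canRL (addrK _) (canRL (addKr _) (canRL (addKr _) o3)).
  rewrite /family_coef; case: i le_i3 => [|[|[|[|]]]] //= _.
  - by rewrite E1 z1 i1 /s -!mul_polyC; ring.
  - by rewrite E2 o2 z2 i2 betaE /s /m -!mul_polyC; ring.
  - by rewrite [LHS]E3 o3 z3 i3 /s /m -!mul_polyC; ring.
move=> [lambda QE].
have := QE 1%N isT; have := QE 2%N isT; have := QE 3%N isT.
rewrite /family_coef /= => Q3 Q2 Q1.
split; [apply/ind0 | apply/ind1 | apply/indoo]; rewrite Q1 Q2 Q3 ?betaE.
- by split; rewrite !hornerE /=; ring.
- by split; rewrite !hornerE /= /s /m; ring.
- by split; rewrite !(coefD, coefZ, coefXn, coefX, coefC) /= /s /m; ring.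
Qed.

Lemma has_schemeP (M : diffop K) :
  has_scheme alpha beta gamma1 gamma2 M
  <-> exists lambda, M = family alpha s m lambda.
Proof.
split.
  case=> monM ordM /(fuchsian01ooP monM ordM)[Q [Q0 sQ ->]].
  move=> /(riemann_schemeP Q0 sQ)[lambda QE]; exists lambda.
  exact: eq_fuchs_op QE.
move=> [lambda ->]; rewrite /family; set Q := family_coef _ _ _ _.
have Q0 : Q 0%N = 1 by [].
have sQ i : (i <= 3)%N -> (size (Q i) <= i.+1)%N by apply: size_family_coef.
have monM := fuchs_op_monic 3 Q0; have ordM := order_fuchs_op 3 Q0.
split=> //; first by apply/(fuchsian01ooP monM ordM); exists Q.
by apply/(riemann_schemeP Q0 sQ); exists lambda.
Qed.
End Scheme.

(** * Euler form and symmetric squares of Gauss operators *)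

Section Euler.
Variable K : fieldType.
Implicit Types (P : {poly K}).

Lemma opcomp_theta_coef (B : diffop K) i :
  (opcomp (theta K) B)`_i
  = zvar K * (rderiv B`_i + (if i is j.+1 then B`_j else 0)).
Proof.
have -> : opcomp (theta K) B = zvar K *: opD B.
  rewrite /opcomp /theta size_scale ?zvar_neq0 // size_polyX !big_ord_recl big_ord0.
  by rewrite !coefZ !coefX /= mulr0 scale0r mulr1 add0r addr0.
rewrite coefZ /opD coefD coefXM coef_map_id0 ?rderiv0 //.
by case: i.
Qed.

Lemma theta_iter1 : iter 1 (opcomp (theta K)) 1 = zvar K *: 'X.
Proof.
apply/polyP=> -[|[|i]]; rewrite /= opcomp_theta_coef !(coefZ, coefX, coef1) /=.
- by rewrite -tofrac1 rderiv_tofrac -polyC1 derivC tofrac0 addr0.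
- by rewrite rderiv0 add0r.
- by rewrite rderiv0 addr0 !mulr0.
Qed.

Lemma rderiv_zvar : rderiv (zvar K) = 1.
Proof. by rewrite rderiv_tofrac derivX tofrac1. Qed.

Lemma theta_iter2 :
  iter 2 (opcomp (theta K)) 1 = zvar K ^+ 2 *: 'X^2 + zvar K *: 'X.
Proof.
apply/polyP=> i; rewrite iterS theta_iter1 opcomp_theta_coef.
case: i => [|[|[|i]]]; rewrite !(coefD, coefZ, coefX, coefXn) /=
  ?(mulr0, mulr1, rderiv0, rderiv_zvar); by ring.
Qed.

Lemma rderiv_zvarX2 : rderiv (zvar K ^+ 2) = 2%:R * zvar K.
Proof.
by rewrite -tofracXn rderiv_tofrac derivXn expr1 tofracMn mulr_natl.
Qed.

Lemma theta_iter3 :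
  iter 3 (opcomp (theta K)) 1
  = zvar K ^+ 3 *: 'X^3 + (3%:R * zvar K ^+ 2) *: 'X^2 + zvar K *: 'X.
Proof.
apply/polyP=> i; rewrite iterS theta_iter2 opcomp_theta_coef.
case: i => [|[|[|[|i]]]]; rewrite !(coefD, coefZ, coefX, coefXn) /=
  ?(mulr0, mulr1, addr0, add0r, rderiv0, rderiv_zvar, rderiv_zvarX2); by ring.
Qed.

Lemma at_theta_cubic (a3 a2 a1 a0 : K) :
  at_theta (a3 *: 'X^3 + a2 *: 'X^2 + a1 *: 'X + a0%:P)
  = (cst a3 * zvar K ^+ 3) *: 'X^3
    + ((3%:R * cst a3 + cst a2) * zvar K ^+ 2) *: 'X^2
    + ((cst a3 + cst a2 + cst a1) * zvar K) *: 'X + (cst a0)%:P.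
Proof.
set P := (X in at_theta X).
have sP : (size P <= 4)%N.
  apply/leq_sizeP=> -[|[|[|[|j]]]] // _.
  by rewrite !(coefD, coefZ, coefXn, coefX, coefC) /= !(mulr0, addr0).
have -> : at_theta P = \sum_(i < 4) cst P`_i *: iter i (opcomp (theta K)) 1.
  rewrite /at_theta.
  rewrite (big_ord_widen _ (fun i => cst P`_i *: iter i (opcomp (theta K)) 1) sP).
  rewrite big_mkcond; apply: eq_bigr => i _; case: ltnP => // le_i.
  by rewrite nth_default // /cst polyC0 tofrac0 scale0r.
have cst0 : cst (0 : K) = 0 by rewrite /cst polyC0 tofrac0.
have [P0 P1 P2 P3] : [/\ P`_0 = a0, P`_1 = a1, P`_2 = a2 & P`_3 = a3].
  by rewrite /P !(coefD, coefZ, coefXn, coefX, coefC) /= !(mulr0, mulr1, addr0, add0r).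
rewrite -(big_mkord xpredT (fun i => cst P`_i *: iter i (opcomp (theta K)) 1)).
do 4 rewrite big_nat_recr //.
rewrite big_geq // theta_iter3 theta_iter2 theta_iter1 P0 P1 P2 P3 /=.
exact: at_theta_id.
Qed.

Lemma fuchs_op3E Q : Q 0%N = 1 ->
  let w := zvar K * (zvar K - 1) in
  fuchs_op 3 Q = 'X^3 + ((Q 1%N)%:F / w) *: 'X^2 + ((Q 2%N)%:F / w ^+ 2) *: 'X
                 + ((Q 3%N)%:F / w ^+ 3)%:P.
Proof.
move=> Q0 w; apply/polyP=> i.
rewrite coef_poly !(coefD, coefZ, coefXn, coefX, coefC).
case: i => [|[|[|[|i]]]] /=; rewrite !(mulr0, mulr1, addr0, add0r) //.
by rewrite Q0 tofrac1 divr1.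
Qed.

Definition cst_morph : {rmorphism K -> ratfun K} := (@FracField.tofrac _ \o polyC)%FUN.

Lemma tofracZ (c : K) (p : {poly K}) : (c *: p)%:F = cst_morph c * p%:F.
Proof. by rewrite -mul_polyC tofracM. Qed.

Lemma familyE (alpha s m lambda : K) :
  family alpha s m lambda = family_at cst_morph (zvar K) alpha s m lambda.
Proof.
rewrite /family (@fuchs_op3E (family_coef alpha s m lambda) (erefl 1)).
rewrite /family_at /family_coef /=.
congr ('X^3 + (_ / _) *: _ + (_ / _) *: _ + (_ / _)%:P).
- by rewrite tofracD tofracZ.
- by rewrite 2!tofracD 2!tofracZ tofracXn.
- by rewrite 2!tofracD 3!tofracZ 2!tofracXn.
Qed.

Lemma euler_formE (alpha gamma1 gamma2 lambda : K) :
  (zvar K ^+ 3 * (zvar K - 1) ^+ 2)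
    *: family alpha (gamma1 + gamma2) (gamma1 * gamma2) lambda
  = euler_form alpha gamma1 gamma2 lambda.
Proof.
rewrite familyE (euler_id cst_morph (zvar_neq0 K) (zvar_sub1_neq0 K)) /euler_form.
set s := gamma1 + gamma2; set m := gamma1 * gamma2.
have -> : 'X * ('X - alpha%:P) * ('X - (2%:R * alpha)%:P)
    = 1 *: 'X^3 + (- 3%:R * alpha) *: 'X^2 + (2%:R * alpha ^+ 2) *: 'X + 0%:P.
  by rewrite -!mul_polyC; ring.
have -> : P1 alpha gamma1 gamma2 - lambda%:P
    = (- 2%:R) *: 'X^3 + (3%:R * (alpha - s)) *: 'X^2
      + (4%:R * alpha * s - 4%:R * m - alpha - s) *: 'X + (- lambda)%:P.
  by rewrite /P1 /s /m -!mul_polyC; ring.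
have -> : ('X + s%:P) * ('X + (2%:R * gamma1)%:P) * ('X + (2%:R * gamma2)%:P)
    = 1 *: 'X^3 + (3%:R * s) *: 'X^2 + (2%:R * s ^+ 2 + 4%:R * m) *: 'X
      + (4%:R * s * m)%:P.
  by rewrite /s /m -!mul_polyC; ring.
by rewrite !at_theta_cubic.
Qed.

Lemma Sym2_gauss (a b c : K) :
  Sym2 (gauss a b c)
  = family (1 - c) (a + b) (a * b) (2%:R * (a * b) * (1 - 2%:R * (1 - c))).
Proof.
rewrite familyE -(gauss_id cst_morph (zvar_neq0 K) (zvar_sub1_neq0 K)).
set d := a + b + 1 - c; set w := 'X * ('X - 1) : {poly K}.
have w0 : w != 0 by rewrite mulf_neq0 ?polyX_eq0 ?X_sub1_neq0.
have wE : zvar K * (zvar K - 1) = w%:F by rewrite zvar_sub1E -tofracM.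
have dw : w^`() = 2%:R * 'X - 1.
  by rewrite derivM derivB derivX -polyC1 derivC; ring.
pose r := (c + d) *: 'X - c%:P.
have rE : r%:F = cst_morph (c + d) * zvar K - cst_morph c.
  by rewrite /r tofracB tofracZ.
have dwE : (w^`())%:F = 2%:R * zvar K - 1.
  by rewrite dw tofracB tofracM tofracMn tofrac1.
have D1 : rderiv (r%:F / w%:F)
    = (cst_morph (c + d) * w%:F - r%:F * (2%:R * zvar K - 1)) / w%:F ^+ 2.
  rewrite (rderivE _ w0) tofracXn -dwE derivB derivC derivZ derivX subr0.
  by rewrite tofracB [in RHS]mulrC -!tofracM alg_polyC [in RHS]mulrC.
have D0 : rderiv ((a * b)%:P%:F / w%:F)
    = - cst_morph (a * b) * (2%:R * zvar K - 1) / w%:F ^+ 2.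
  by rewrite (rderivE _ w0) tofracXn -dwE derivC mul0r sub0r tofracN tofracM !mulNr.
have G1 : (gauss a b c)`_1 = r%:F / w%:F.
  rewrite !(coefD, coefZ, coefXn, coefX, coefC) /= mulr1 add0r addr0.
  rewrite rE -wE.
  exact: (partial_fractions cst_morph (zvar_neq0 K) (zvar_sub1_neq0 K) c d).
have G0 : (gauss a b c)`_0 = (a * b)%:P%:F / w%:F.
  by rewrite !(coefD, coefZ, coefXn, coefX, coefC) /= mulr0 !add0r wE.
by rewrite /Sym2 G1 G0 D1 D0 -wE rE.
Qed.
End Euler.

(** * Recovering the parameters *)

Section Injectivity.
Variable K : numFieldType.

(** [Q_1] gives [alpha] and [s], then the leading coefficient of [Q_2] gives
    [m], and [Q_3] gives [lambda]. *)
Lemma family_inj (alpha s m lambda alpha' s' m' lambda' : K) :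
  family alpha s m lambda = family alpha' s' m' lambda' ->
  [/\ alpha = alpha', s = s', m = m' & lambda = lambda'].
Proof.
move=> /fuchs_op_inj e.
have co i j : (i <= 3)%N -> (family_coef alpha s m lambda i)`_j
    = (family_coef alpha' s' m' lambda' i)`_j by move=> /e ->.
move: (co 1%N 0%N isT) (co 1%N 1%N isT) (co 2%N 2%N isT) (co 3%N 1%N isT).
rewrite /family_coef /= !(coefD, coefN, coefZ, coefXn, coefX, coefC) /=.
rewrite !(mulr0, mulr1, addr0, add0r) => ea es em el.
have n3 : 3%:R != 0 :> K by rewrite Num.Theory.pnatr_eq0.
have n4 : 4%:R != 0 :> K by rewrite Num.Theory.pnatr_eq0.
have {}es : s = s' by move: es => /(mulfI n3)/addrI.
rewrite es in em; split=> //; last by move: em => /addrI/(mulfI n4).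
have nn3 : - 3%:R != 0 :> K by rewrite oppr_eq0.
by move: ea => /(mulfI nn3)/addrI/oppr_inj.
Qed.

End Injectivity.

Lemma same_sum_prod (K : idomainType) (a b c d : K) :
  a + b = c + d -> a * b = c * d -> a = c /\ b = d \/ a = d /\ b = c.
Proof.
move=> es ep.
have : (a - c) * (a - d) == 0.
  have -> : (a - c) * (a - d) = a * a - a * (c + d) + c * d by ring.
  by rewrite -es -ep; apply/eqP; ring.
rewrite mulf_eq0 !subr_eq0 => /orP[] /eqP e; [left|right]; split=> //;
  apply: (@addrI _ a); rewrite es e //; exact: addrC.
Qed.

(** The special parameters of the theorem are instances of this rather than
    limits of generic ones: the formulas are polynomial in the parameters, and 3
    and 4 are the only constants that are ever cancelled. *)
Lemma sym2_family (K : numClosedFieldType) (alpha beta gamma1 gamma2 : K) :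
  alpha + beta + gamma1 + gamma2 = 1 ->
  exists L : K -> diffop K,
      [/\ injective L,
          forall M : diffop K,
            has_scheme alpha beta gamma1 gamma2 M <->
            exists lambda, M = L lambda
        & forall lambda,
            (zvar K ^+ 3 * (zvar K - 1) ^+ 2) *: L lambda
            = euler_form alpha gamma1 gamma2 lambda]
      /\ (forall lambda,
            (exists a b c, L lambda = Sym2 (gauss a b c)) <->
            lambda = lambda0 alpha gamma1 gamma2)
      /\ L (lambda0 alpha gamma1 gamma2)
           = Sym2 (gauss gamma1 gamma2 (1 - alpha))
      /\ (forall a b c,
            L (lambda0 alpha gamma1 gamma2) = Sym2 (gauss a b c) ->
            c = 1 - alpha /\
            (a = gamma1 /\ b = gamma2 \/ a = gamma2 /\ b = gamma1)).
Proof.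
move=> fuchs; exists (family alpha (gamma1 + gamma2) (gamma1 * gamma2)).
have Sym2L :
    family alpha (gamma1 + gamma2) (gamma1 * gamma2) (lambda0 alpha gamma1 gamma2)
    = Sym2 (gauss gamma1 gamma2 (1 - alpha)).
  by rewrite Sym2_gauss /lambda0 subKr mulrA.
split; [split|split; [|split]].
- by move=> lambda mu /family_inj[].
- by move=> M; apply: has_schemeP.
- by move=> lambda; apply: euler_formE.
- move=> lambda; split=> [[a [b [c]]]|->]; last by exists gamma1, gamma2, (1 - alpha).
  by rewrite Sym2_gauss => /family_inj[-> _ <- ->]; rewrite /lambda0 mulrA.
- exact: Sym2L.
- move=> a b c; rewrite Sym2_gauss => /family_inj[alphaE sE mE _].
  by split; [rewrite alphaE subKr | apply: same_sum_prod].
Qed.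

Theorem theorem4p11 (R : realType) :
  let conclusions (alpha beta gamma1 gamma2 : R[i]) : Prop :=
    exists L : R[i] -> diffop R[i],
      (* (a) *)
      [/\ injective L,
          forall M : diffop R[i],
            has_scheme alpha beta gamma1 gamma2 M <->
            exists lambda, M = L lambda
        & forall lambda,
            (zvar R[i] ^+ 3 * (zvar R[i] - 1) ^+ 2) *: L lambda
            = euler_form alpha gamma1 gamma2 lambda]
      (* (b) *)
      /\ (forall lambda,
            (exists a b c, L lambda = Sym2 (gauss a b c)) <->
            lambda = lambda0 alpha gamma1 gamma2)
      (* (c) *)
      /\ L (lambda0 alpha gamma1 gamma2)
           = Sym2 (gauss gamma1 gamma2 (1 - alpha))
      /\ (forall a b c,
            L (lambda0 alpha gamma1 gamma2) = Sym2 (gauss a b c) ->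
            c = 1 - alpha /\
            (a = gamma1 /\ b = gamma2 \/ a = gamma2 /\ b = gamma1))
  in
  [/\ forall alpha beta gamma1 gamma2 : R[i],
        alpha + beta + gamma1 + gamma2 = 1 ->
        generic_locus alpha beta gamma1 gamma2 ->
        genuine_order3 alpha gamma1 gamma2 ->
        conclusions alpha beta gamma1 gamma2,
      forall alpha beta gamma1 gamma2 : R[i],
        alpha + beta + gamma1 + gamma2 = 1 ->
        genuine_order3 alpha gamma1 gamma2 ->
        conclusions alpha beta gamma1 gamma2,
      conclusions 0 0 2%:R^-1 2%:R^-1
    & conclusions (- 2%:R^-1) 0 2%:R^-1 1].
Proof.
have half2 : 2%:R^-1 + 2%:R^-1 = 1 :> R[i].
  by field.
split.
- by move=> alpha beta gamma1 gamma2 fuchs _ _; apply: sym2_family.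
- by move=> alpha beta gamma1 gamma2 fuchs _; apply: sym2_family.
- by apply: sym2_family; rewrite !add0r.
- by apply: sym2_family; rewrite addr0 addNr add0r.
Qed.
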